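(* There is an absolute constant $c>0$ such that for every prime $p\geq 3$ and every set $A\subseteq \mathbb{Z}/p\mathbb{Z}$ with $|A|=\lfloor p/2\rfloor$ one has \[ \sum_{r\in\mathbb{Z}/p\mathbb{Z}} |\widehat{1_A}(r)| \;\geq\; c\left(\frac{\log p}{\log\log p}\right)^{1/3}. \]
   Context: For $f:\mathbb{Z}/p\mathbb{Z}\to\mathbb{R}$ the Fourier transform is $\widehat{f}(r):=\frac1p\sum_{x\in\mathbb{Z}/p\mathbb{Z}} f(x)e^{2\pi i rx/p}$ for $r\in\mathbb{Z}/p\mathbb{Z}$. $1_A$ is the characteristic function of $A$. *)

(* Defs.v *)
From HB Require Import structures.
From mathcomp Require Import all_boot all_order all_algebra.
From mathcomp Require Import reals exp trigo.
From mathcomp.real_closed Require Import complex.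

Set Implicit Arguments.
Unset Strict Implicit.
Unset Printing Implicit Defensive.

Import Order.TTheory GRing.Theory Num.Theory.
Local Open Scope ring_scope.
Local Open Scope complex_scope.

Definition expi (R : realType) (t : R) : R[i] := cos t +i* sin t.

(* Meant for p prime: 'F_p is Z/pZ only then. r and x enter the exponent
   through their representatives in {0, .., p - 1}. *)
Definition fourier (R : realType) (p : nat) (f : 'F_p -> R) (r : 'F_p) : R[i] :=
  (p%:R)^-1 * \sum_(x : 'F_p) (f x)%:C * expi (2 * pi * (r * x)%N%:R / p%:R).

Definition charfun (R : realType) (p : nat) (A : {set 'F_p}) : 'F_p -> R :=
  fun x => (x \in A)%:R.

Definition modulus (R : realType) (z : R[i]) : R := ComplexField.Normc.normc z.

(* Main.v *)
(* Put f = 1_A - |A|/p and let m bound the l1 norm of its Fourier transform a.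
   Cover the spectrum in levels: on a regular Bohr set B_j of the current
   frequencies, greedily pick frequencies s seeing much of the remaining mass,
   and add to the covered set C_j all r with a large mean of e(r - s) over B_j;
   such r are almost constant on the next, narrower Bohr set. Among O(m) levels
   one adds little mass. There f = f_C + f_new + f_U with f_C almost invariant
   under the Bohr set, f_new uniformly small, and f_U small in mean square on
   every translate of B_j. Since |f| >= 1/3 everywhere, |f_C| >= 1/8 everywhere.
   If the Bohr set contained some t <> 0, then f_C would have constant sign
   along x, x + t, x + 2t, .., that is, on all of Z/pZ, although it has mean
   zero. So the Bohr set is {0}, while pigeonhole makes it larger once p
   exceeds (m log p)^(O(m^3)). *)

Require Import Defs.
From mathcomp Require Import all_boot all_order all_algebra.
From mathcomp Require Import reals sequences exp trigo.
From mathcomp.real_closed Require Import complex.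
From mathcomp Require Import ring lra.

Set Implicit Arguments.
Unset Strict Implicit.
Unset Printing Implicit Defensive.

Import Order.TTheory GRing.Theory Num.Theory.
Local Open Scope ring_scope.
Local Open Scope complex_scope.

Local Notation normc := ComplexField.Normc.normc.
Local Notation Re := complex.Re.
Local Notation Im := complex.Im.

(** * Moduli of complex numbers *)

Section ComplexModulus.
Variable R : rcfType.
Implicit Types z w : R[i].

Lemma normc_ge0 z : 0 <= normc z.
Proof. by case: z => a b; rewrite /normc sqrtr_ge0. Qed.

Lemma normr_normc z : `|z| = (normc z)%:C.
Proof. by case: z => a b; rewrite normc_def. Qed.

Lemma ler_normcD z w : normc (z + w) <= normc z + normc w.
Proof. exact: le_normcD. Qed.

Lemma normcN z : normc (- z) = normc z.
Proof. exact: (@complex.normcN R). Qed.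

Lemma ler_normc_sum (I : Type) (s : seq I) (P : pred I) (F : I -> R[i]) :
  normc (\sum_(i <- s | P i) F i) <= \sum_(i <- s | P i) normc (F i).
Proof.
elim/big_rec2: _ => [|i y x _ le]; first by rewrite ComplexField.Normc.normc0.
by apply: le_trans (ler_normcD _ _) _; rewrite lerD2l.
Qed.

Lemma normc_conj z : normc (Num.conj z) = normc z.
Proof.
by have := norm_conjC z; rewrite !normr_normc => -[].
Qed.

Lemma normc_sqr z : (normc z ^+ 2)%:C = z * Num.conj z.
Proof. by rewrite -normCK normr_normc rmorphXn. Qed.

Lemma normc_real (a : R) : normc a%:C = `|a|.
Proof. by rewrite /normc /= expr0n addr0 sqrtr_sqr. Qed.

Lemma ler_Re_normc z : `|Re z| <= normc z.
Proof. by have := normc_ge_Re z; rewrite normr_normc lecR. Qed.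

Lemma ler_Im_normc z : `|Im z| <= normc z.
Proof.
have := ler_Re_normc (z * 'i%C); rewrite ReiNIm normrN.
by rewrite ComplexField.Normc.normcM /normc /= expr0n expr1n add0r sqrtr1 mulr1.
Qed.

Lemma ler_normc_ReIm z : normc z <= `|Re z| + `|Im z|.
Proof.
case: z => a b /=; rewrite -(@ler_pXn2r _ 2) ?nnegrE ?sqrtr_ge0 ?addr_ge0 //.
rewrite sqr_sqrtr ?addr_ge0 ?sqr_ge0 // sqrrD !real_normK ?num_real //.
by rewrite addrAC lerDl mulrn_wge0 ?mulr_ge0.
Qed.

Lemma Re_sum (I : Type) (s : seq I) (P : pred I) (F : I -> R[i]) :
  Re (\sum_(i <- s | P i) F i) = \sum_(i <- s | P i) Re (F i).
Proof. by elim/big_rec2: _ => // i y x _ <-; case: (F i) x => ? ? []. Qed.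

End ComplexModulus.

(** * Bohr sets of a bicharacter on a finite abelian group *)

Section Bicharacter.
Variables (R : realType) (G : finZmodType) (e : G -> G -> R[i]).
Hypothesis eDl : forall x y r, e (x + y) r = e x r * e y r.
Hypothesis eDr : forall r x y, e r (x + y) = e r x * e r y.
Hypothesis e_normc : forall r x, normc (e r x) = 1.

Lemma e_neq0 r x : e r x != 0.
Proof.
apply/eqP => e0; have := e_normc r x; rewrite e0 ComplexField.Normc.normc0.
by move/eqP; rewrite eq_sym oner_eq0.
Qed.

Lemma er0 r : e r 0 = 1.
Proof. by apply: (mulfI (e_neq0 r 0)); rewrite -eDr addr0 mulr1. Qed.

Lemma e0r x : e 0 x = 1.
Proof. by apply: (mulfI (e_neq0 0 x)); rewrite -eDl addr0 mulr1. Qed.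

Lemma e_conj r x : Num.conj (e r x) = e (- r) x.
Proof.
apply: (mulfI (e_neq0 r x)).
by rewrite -normc_sqr e_normc expr1n -eDl subrr e0r.
Qed.

Lemma e_sub1D r x y :
  normc (e r (x + y) - 1) <= normc (e r x - 1) + normc (e r y - 1).
Proof.
have -> : e r (x + y) - 1 = e r y * (e r x - 1) + (e r y - 1).
  by rewrite eDr; ring.
apply: le_trans (ler_normcD _ _) _.
by rewrite ComplexField.Normc.normcM e_normc mul1r.
Qed.

Lemma e_sub1Dl r s x :
  normc (e (r + s) x - 1) <= normc (e r x - 1) + normc (e s x - 1).
Proof.
have -> : e (r + s) x - 1 = e s x * (e r x - 1) + (e s x - 1).
  by rewrite eDl; ring.
apply: le_trans (ler_normcD _ _) _.
by rewrite ComplexField.Normc.normcM e_normc mul1r.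
Qed.

Definition bohr (S : seq G) (rho : R) : {set G} :=
  [set x | all (fun r => normc (e r x - 1) <= rho) S].

Lemma bohrP S rho x :
  reflect (forall r, r \in S -> normc (e r x - 1) <= rho) (x \in bohr S rho).
Proof. by rewrite inE; apply: allP. Qed.

Lemma bohr0 S rho : 0 <= rho -> 0 \in bohr S rho.
Proof.
move=> rho0; apply/bohrP => r _.
by rewrite er0 subrr ComplexField.Normc.normc0.
Qed.

Lemma bohrS S rho rho' : rho <= rho' -> bohr S rho \subset bohr S rho'.
Proof.
by move=> le; apply/subsetP => x /bohrP h; apply/bohrP => r /h /le_trans ->.
Qed.

Lemma bohr_cat S S' rho :
  bohr (S ++ S') rho = bohr S rho :&: bohr S' rho.
Proof. by apply/setP => x; rewrite !inE all_cat. Qed.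

Lemma bohrD S rho rho' x y :
  x \in bohr S rho -> y \in bohr S rho' -> x + y \in bohr S (rho + rho').
Proof.
move=> /bohrP hx /bohrP hy; apply/bohrP => r rS.
by apply: le_trans (e_sub1D _ _ _) _; apply: lerD; [apply: hx | apply: hy].
Qed.

Definition mean_char (B : {set G}) (r : G) : R :=
  normc (\sum_(y in B) e r y) / #|B|%:R.

Lemma sum_char_le (B : {set G}) r : normc (\sum_(y in B) e r y) <= #|B|%:R.
Proof.
apply: le_trans (ler_normc_sum _ _ _) _.
by rewrite (eq_bigr (fun=> 1)) ?sumr_const //.
Qed.

Lemma mean_char_le1 (B : {set G}) r : mean_char B r <= 1.
Proof.
rewrite /mean_char; have [->|B0] := posnP #|B|; first by rewrite invr0 mulr0.
by rewrite ler_pdivrMr ?ltr0n // mul1r sum_char_le.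
Qed.

(** If each of the [n] steps multiplied the cardinality by more than [1 + tau], it would grow from
    at least 1, as 0 lies in the first set, past [#|G|]. *)
Lemma bohr_regular S (kappa tau : R) n : 0 < kappa -> 0 < tau ->
    #|G|%:R < (1 + tau) ^+ n ->
  exists2 i, (i < n)%N & #|bohr S (i.+1%:R * kappa)|%:R
                  <= (1 + tau) * #|bohr S (i%:R * kappa)|%:R.
Proof.
move=> k0 t0 ltn.
suff H m : (m <= n)%N ->
   (exists2 i, (i < n)%N & #|bohr S (i.+1%:R * kappa)|%:R
                  <= (1 + tau) * #|bohr S (i%:R * kappa)|%:R) \/
   (1 + tau) ^+ m <= #|bohr S (m%:R * kappa)|%:R.
  have [//|/(lt_le_trans ltn)] := H n (leqnn n).
  by rewrite ltr_nat ltnNge max_card.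
elim: m => [_|m IH lt]; last first.
  have [|//|IH'] := IH; [exact: ltnW | by left |].
  case: (leP #|bohr S (m.+1%:R * kappa)|%:R
           ((1 + tau) * #|bohr S (m%:R * kappa)|%:R)) => [le|/ltW le].
    by left; exists m.
  right; rewrite exprS; apply: le_trans le; apply: ler_wpM2l => //.
  by rewrite addr_ge0 ?ltW.
right; rewrite expr0 ler1n card_gt0; apply/set0Pn; exists 0.
by rewrite bohr0 // mul0r.
Qed.

(** The factor [e r t] moves the character sum over [B] to the translate of [B] by [t]. Both sets
    lie in the next Bohr set, which exceeds each by at most [tau * #|B|] points. So a character with
    a large mean on [B] is close to 1 at [t]. *)
Lemma mean_char_translate S (kappa tau : R) i r t :
    #|bohr S (i.+1%:R * kappa)|%:R
                  <= (1 + tau) * #|bohr S (i%:R * kappa)|%:R ->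
    0 <= kappa -> t \in bohr S kappa ->
  mean_char (bohr S (i%:R * kappa)) r * normc (e r t - 1) <= 2 * tau.
Proof.
set B := bohr S (i%:R * kappa); set B' := bohr S _.
move=> card_le k0 tS.
have B0 : (0 < #|B|)%N.
  by rewrite card_gt0; apply/set0Pn; exists 0; rewrite bohr0 // mulr_ge0.
rewrite /mean_char mulrAC ler_pdivrMr ?ltr0n // -ComplexField.Normc.normcM.
pose Bt := [set y + t | y in B].
have sBB' : B \subset B' by apply: bohrS; rewrite ler_wpM2r ?ler_nat.
have sBtB' : Bt \subset B'.
  apply/subsetP => _ /imsetP[y yB ->].
  by rewrite /B' -natr1 mulrDl mul1r bohrD.
have cardBt : #|Bt| = #|B| by rewrite card_imset //; exact: addIr.
have -> : (\sum_(y in B) e r y) * (e r t - 1) =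
    \sum_(y in B' :\: B) e r y - \sum_(y in B' :\: Bt) e r y.
  have E (D : {set G}) : D \subset B' ->
      \sum_(y in B') e r y = \sum_(y in D) e r y + \sum_(y in B' :\: D) e r y.
    by move=> /setIidPr sD; rewrite (big_setID D) /= sD.
  have im : \sum_(y in Bt) e r y = (\sum_(y in B) e r y) * e r t.
    rewrite big_imset /=; last by move=> ? ? _ _; exact: addIr.
    by rewrite mulr_suml; apply: eq_bigr => y _; rewrite eDr.
  rewrite mulrBr mulr1 -im.
  rewrite -[\sum_(y in Bt) _](addrK (\sum_(y in B' :\: Bt) e r y)) -E //.
  by rewrite (E B) //; ring.
apply: le_trans (ler_normcD _ _) _; rewrite normcN.
have cD (D : {set G}) : D \subset B' -> #|D| = #|B| ->
    normc (\sum_(y in B' :\: D) e r y) <= tau * #|B|%:R.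
  move=> sD cD; apply: le_trans (sum_char_le _ _) _.
  rewrite cardsD (setIidPr sD) natrB ?subset_leq_card // cD.
  by rewrite lerBlDr; move: card_le; rewrite mulrDl mul1r addrC.
have := cD _ sBB' erefl; have := cD _ sBtB' cardBt; lra.
Qed.

(** * Trigonometric polynomials: mass and local energy *)

Variable a : G -> R[i].
Implicit Types U V : {set G}.

Definition wt (U : {set G}) : R := \sum_(r in U) normc (a r).
Definition trig (U : {set G}) (x : G) : R[i] := \sum_(r in U) a r * e r x.

Lemma wt_ge0 U : 0 <= wt U.
Proof. by apply: sumr_ge0 => r _; exact: normc_ge0. Qed.

Lemma wtD U V : U \subset V -> wt V = wt U + wt (V :\: U).
Proof. by move=> /setIidPr sUV; rewrite /wt (big_setID U) /= sUV. Qed.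

Lemma wtS U V : U \subset V -> wt U <= wt V.
Proof. by move=> /wtD ->; rewrite lerDl wt_ge0. Qed.

Lemma trigD U V x : U \subset V -> trig V x = trig U x + trig (V :\: U) x.
Proof. by move=> /setIidPr sUV; rewrite /trig (big_setID U) /= sUV. Qed.

Lemma normc_trig U x : normc (trig U x) <= wt U.
Proof.
apply: le_trans (ler_normc_sum _ _ _) _; apply: ler_sum => r _.
by rewrite ComplexField.Normc.normcM e_normc mulr1.
Qed.

(** Expand the square and sum over [y] first: the pair [r], [s] costs its two coefficients times
    [#|B| * mean_char B (r - s)], and the hypothesis bounds the sum over [r] for each fixed [s]. *)
Lemma trig_energy (B U : {set G}) (eps : R) x :
    (forall s, \sum_(r in U) normc (a r) * mean_char B (r - s) <= eps) ->
  \sum_(y in B) normc (trig U (x + y)) ^+ 2 <= #|B|%:R * (wt U * eps).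
Proof.
move=> small.
have [B0|B0] := posnP #|B|.
  by rewrite (cards0_eq B0) big_set0 cards0 mul0r.
rewrite -[leLHS]ger0_norm; last by apply: sumr_ge0 => y _; exact: sqr_ge0.
rewrite -normc_real.
have -> : (\sum_(y in B) normc (trig U (x + y)) ^+ 2)%:C =
   \sum_(s in U) \sum_(r in U)
     a r * Num.conj (a s) * e (r - s) x * \sum_(y in B) e (r - s) y.
  rewrite rmorph_sum /=.
  transitivity (\sum_(y in B) \sum_(s in U) \sum_(r in U)
      a r * Num.conj (a s) * e (r - s) x * e (r - s) y).
    apply: eq_bigr => y _; rewrite normc_sqr [in RHS]exchange_big /= mulr_suml.
    apply: eq_bigr => r _; rewrite rmorph_sum mulr_sumr.
    apply: eq_bigr => s _; rewrite rmorphM /= e_conj -[in RHS]mulrA -eDr eDl.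
    by ring.
  rewrite exchange_big; apply: eq_bigr => s _; rewrite exchange_big.
  by apply: eq_bigr => r _; rewrite mulr_sumr.
apply: le_trans (ler_normc_sum _ _ _) _.
rewrite mulrCA /wt mulr_suml; apply: ler_sum => s _.
apply: le_trans (ler_normc_sum _ _ _) _.
apply: (@le_trans _ _ (normc (a s) *
   (#|B|%:R * \sum_(r in U) normc (a r) * mean_char B (r - s)))).
  rewrite !mulr_sumr; apply: ler_sum => r _.
  rewrite !ComplexField.Normc.normcM normc_conj e_normc /mean_char mulr1.
  rewrite le_eqVlt; apply/orP; left; apply/eqP.
  by field; rewrite pnatr_eq0 -lt0n.
by rewrite !ler_wpM2l ?normc_ge0.
Qed.

Lemma trig_small_point (B U : {set G}) (eps : R) x : (0 < #|B|)%N ->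
    (forall s, \sum_(r in U) normc (a r) * mean_char B (r - s) <= eps) ->
  exists2 y, y \in B & normc (trig U (x + y)) ^+ 2 <= wt U * eps.
Proof.
move=> B0 small; apply/exists_inP; apply: contraT => /exists_inPn big.
have := trig_energy x small; rewrite leNgt => /negP[].
rewrite mulr_natl -sumr_const; apply: ltr_sum.
  by case/card_gt0P: B0 => y yB; apply/hasP; exists y.
by move=> y /big; rewrite -ltNge.
Qed.

(* Greedy choice: as long as some s sees more than eps of the mass of U, remove
   from U all the frequencies that s resonates with. *)
Lemma greedy_cover (B U0 : {set G}) (eps eta : R) :
    0 < eps -> 0 <= eta -> eta * wt U0 <= eps / 2 ->
  exists (S : seq G) (U : {set G}), [/\ U \subset U0,
    forall s, \sum_(r in U) normc (a r) * mean_char B (r - s) <= eps,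
    (size S)%:R * (eps / 2) <= wt (U0 :\: U) &
    forall r, r \in U0 :\: U ->
      exists2 s, s \in S & eta <= mean_char B (r - s)].
Proof.
move=> eps0 eta0; have [n] := ubnP #|U0|; elim: n U0 => // n IH U0 leU etaU.
case: (boolP [forall s,
   \sum_(r in U0) normc (a r) * mean_char B (r - s) <= eps]).
  move=> /forallP small; exists [::], U0; split=> //.
    by rewrite mul0r wt_ge0.
  by move=> r; rewrite setDv inE.
rewrite negb_forall => /existsP[s]; rewrite -ltNge => big.
pose N := [set r in U0 | eta <= mean_char B (r - s)].
have sN : N \subset U0 by apply/subsetP => r; rewrite inE => /andP[].
(* Frequencies outside [N] contribute at most [eta * wt U0 <= eps / 2] to a sum exceeding [eps]. The
   mass of [N] pays for the choice of [s], and it makes [N] nonempty, so the recursion descends. *)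
have wtN : eps / 2 <= wt N.
  have le1 : \sum_(r in U0) normc (a r) * mean_char B (r - s)
      <= wt N + eta * wt (U0 :\: N).
    rewrite (big_setID N) /= (setIidPr sN); apply: lerD.
      apply: ler_sum => r _; rewrite -[leRHS]mulr1.
      by rewrite ler_wpM2l ?normc_ge0 ?mean_char_le1.
    rewrite /wt mulr_sumr; apply: ler_sum => r.
    rewrite !inE => /andP[+ rU0]; rewrite rU0 /= -ltNge => /ltW lt.
    by rewrite mulrC ler_wpM2r ?normc_ge0.
  have : eta * wt (U0 :\: N) <= eta * wt U0 by rewrite ler_wpM2l ?wtS ?subsetDl.
  by lra.
have N0 : (0 < #|N|)%N.
  rewrite card_gt0; apply/eqP => N0; move: wtN.
  by rewrite N0 /wt big_set0; lra.
have [||S [U [sU small szS cov]]] := IH (U0 :\: N).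
- rewrite cardsD (setIidPr sN); apply: (leq_trans _ (ltnSE leU)).
  by rewrite ltn_subrL N0 (leq_trans N0 (subset_leq_card sN)).
- by apply: le_trans etaU; rewrite ler_wpM2l ?wtS ?subsetDl.
exists (s :: S), U; split=> //.
- exact: subset_trans sU (subsetDl _ _).
- have sNU : N \subset U0 :\: U.
    apply/subsetP => r rN; rewrite inE (subsetP sN) // andbT.
    by apply/negP => /(subsetP sU); rewrite inE rN.
  rewrite (wtD sNU) /= -natr1 mulrDl mul1r addrC lerD //.
  have -> : U0 :\: U :\: N = U0 :\: N :\: U by rewrite !setDDl setUC.
  by [].
move=> r; rewrite inE => /andP[rU rU0].
have [|rN] := boolP (r \in N).
  by rewrite inE => /andP[_ le]; exists s; rewrite ?mem_head.
have [|s' s'S le] := cov r; first by rewrite !in_setD rU rN.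
by exists s'; rewrite // inE s'S orbT.
Qed.

(** The factor 2 allows for splitting a covered [r] as [(r - s) + s], each of the two characters
    being within [delta] of 1. *)
Definition almost_invariant (S : seq G) (C : {set G}) (rho delta : R) :=
  forall r t, r \in C -> t \in bohr S rho -> normc (e r t - 1) <= 2 * delta.

(** * Covering the spectrum level by level *)

Section Levels.
Variables (M eps eta delta tau : R) (n : nat).
Hypotheses (eps_gt0 : 0 < eps) (eta_gt0 : 0 < eta) (tau_gt0 : 0 < tau).
Hypotheses (delta_gt0 : 0 < delta) (wtM : wt [set: G] <= M).
Hypotheses (etaM : eta * M <= eps / 2) (tau_le : 2 * tau <= eta * delta).
Hypothesis n_large : #|G|%:R < (1 + tau) ^+ n.

Lemma wt_leM U : wt U <= M.
Proof. by apply: le_trans wtM; rewrite wtS ?subsetT. Qed.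

(** Cut the radius into [n.+1] widths [kappa] and run the greedy choice on a regular [B] among the
    resulting Bohr sets. For a newly covered [r = (r - s) + s], [mean_char_translate] controls
    [r - s] with error [2 * tau / eta <= delta], and [s] is one of the new frequencies. The
    uncovered part is small somewhere on each translate of [B]. *)
Lemma cover_step (S : seq G) (C : {set G}) (rho : R) :
    0 < rho -> rho <= delta -> (size S)%:R * (eps / 2) <= wt C ->
    almost_invariant S C rho delta ->
  exists (S' : seq G) (C' : {set G}), [/\ C \subset C',
    (size S')%:R * (eps / 2) <= wt C',
    almost_invariant S' C' (rho / n.+1%:R) delta &
    forall x, exists2 y, y \in bohr S rho &
      normc (trig (~: C') (x + y)) ^+ 2 <= M * eps].
Proof.
move=> rho0 rhod szS inv; set kappa := rho / n.+1%:R.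
have k0 : 0 < kappa by rewrite divr_gt0 ?ltr0n.
have kn : n.+1%:R * kappa = rho by rewrite mulrC divfK // pnatr_eq0.
have k_rho : kappa <= rho by rewrite -kn ler_peMl ?ler1n // ltW.
have [i ltin reg] := bohr_regular S k0 tau_gt0 n_large.
set B := bohr S (i%:R * kappa).
have sB : B \subset bohr S rho.
  by apply: bohrS; rewrite -kn ler_wpM2r ?ler_nat ?(ltW k0) // ltnW // ltnW.
have [||T [U [sU small szT cov]]] := @greedy_cover B (~: C) eps eta eps_gt0.
- exact: ltW.
- by apply: le_trans etaM; rewrite ler_wpM2l ?wt_leM // ltW.
have sCU : C \subset ~: U by rewrite subsetC.
have UE : ~: U :\: C = ~: C :\: U by rewrite !setDE setIC.
exists (S ++ T), (~: U); split=> //.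
- by rewrite (wtD sCU) UE size_cat natrD mulrDl lerD.
- move=> r t rU; rewrite bohr_cat inE => /andP[tS tT].
  have [rC|rC] := boolP (r \in C).
    by apply: inv => //; apply: (subsetP (bohrS _ k_rho)).
  have [|s sT le] := cov r; first by rewrite -UE !inE rC -in_setC.
  rewrite -[r](subrK s); apply: le_trans (e_sub1Dl _ _ _) _.
  rewrite mulr_natl mulr2n; apply: lerD; last first.
    have /bohrP/(_ s sT) le' := tT.
    by apply: le_trans le' (le_trans k_rho rhod).
  have := mean_char_translate (r - s) reg (ltW k0) tS.
  move=> /le_trans/(_ tau_le) h; rewrite -(ler_pM2l eta_gt0).
  by apply: le_trans h; rewrite ler_wpM2r ?normc_ge0.
move=> x; rewrite setCK.
have [|y yB le] := trig_small_point x _ small.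
  by rewrite card_gt0; apply/set0Pn; exists 0; rewrite bohr0 // mulr_ge0 // ltW.
exists y; first exact: (subsetP sB).
by apply: le_trans le _; rewrite ler_wpM2r ?wt_leM // ltW.
Qed.

(* Each level either covers a further mass theta or stops with little new mass;
   the total mass is at most M. *)
Lemma good_level (theta : R) (J : nat) : M < J%:R * theta ->
  exists (S : seq G) (C C' : {set G}) (rho : R), [/\ C \subset C',
    delta / n.+1%:R ^+ J <= rho /\ (size S)%:R * (eps / 2) <= M,
    almost_invariant S C rho delta,
    wt (C' :\: C) <= theta &
    forall x, exists2 y, y \in bohr S rho &
      normc (trig (~: C') (x + y)) ^+ 2 <= M * eps].
Proof.
set good := (X in _ -> X) => MJ.
suff H j : (j <= J)%N -> good \/
    exists (S : seq G) (C : {set G}),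
    [/\ (size S)%:R * (eps / 2) <= wt C,
     almost_invariant S C (delta / n.+1%:R ^+ j) delta & j%:R * theta <= wt C].
  have [//|[S [C [_ _ le]]]] := H J (leqnn _).
  by have := lt_le_trans MJ (le_trans le (wt_leM C)); rewrite ltxx.
elim: j => [_|j IH ltj].
  right; exists [::], set0; split; rewrite ?mul0r ?wt_ge0 //.
  by move=> r t; rewrite inE.
have [g|[S [C [szS inv le]]]] := IH (ltnW ltj); first by left.
set rho := delta / n.+1%:R ^+ j.
have n1 k : 1 <= n.+1%:R ^+ k :> R by rewrite exprn_ege1 // ler1n.
have rho0 : 0 < rho by rewrite divr_gt0 // exprn_gt0.
have rhod : rho <= delta.
  by rewrite ler_pdivrMr ?exprn_gt0 // ler_peMr ?n1 // ltW.
have [S' [C' [sC szS' inv' ex]]] := cover_step rho0 rhod szS inv.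
have [lew|ltw] := leP (wt (C' :\: C)) theta.
  left; exists S, C, C', rho; split=> //; split.
    rewrite ler_pM2l // lef_pV2 ?posrE ?exprn_gt0 //.
    by rewrite ler_weXn2l ?ler1n // ltnW.
  exact: le_trans szS (wt_leM C).
right; exists S', C'; split=> //.
  by rewrite exprSr invfM mulrA.
by rewrite (wtD sC) -natr1 mulrDl mul1r lerD // ltW.
Qed.

End Levels.

(** * From a good level to a bound on the order of a cyclic group *)

Hypothesis sum_e : forall r, r != 0 -> \sum_x e r x = 0.
Hypothesis G_cyclic : forall t x : G, t != 0 -> exists n, x = t *+ n.

(* A discrete intermediate value theorem: Re (trig C) has mean zero, moves by at
   most 1/24 along the step t, and would have to stay above 1/8 in modulus. *)
Lemma no_small_period (S : seq G) (C C' : {set G}) (M eps rho delta : R)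
    (t : G) :
    a 0 = 0 -> (forall x, 1 / 3 <= `|Re (trig [set: G] x)|) ->
    wt [set: G] <= M -> M * eps <= 1 / 144 -> M * delta <= 1 / 48 ->
    0 <= delta ->
    C \subset C' -> almost_invariant S C rho delta -> wt (C' :\: C) <= 1 / 12 ->
    (forall x, exists2 y, y \in bohr S rho &
      normc (trig (~: C') (x + y)) ^+ 2 <= M * eps) ->
  t \in bohr S rho -> t = 0.
Proof.
move=> a0 fbig wtM Meps Mdelta delta0 sC inv wtD small tS.
apply/eqP; apply: contraT => t0.
pose g x := Re (trig C x).
(* Each character in [C] moves by at most [2 * delta], which costs at most [2 * M * delta <= 1 / 24]
   in total. *)
have slow x y : y \in bohr S rho -> `|g (x + y) - g x| <= 1 / 24.
  move=> yS; have -> : g (x + y) - g x = Re (trig C (x + y) - trig C x).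
    by rewrite /g; case: (trig C (x + y)) (trig C x) => ? ? [].
  apply: le_trans (ler_Re_normc _) _.
  have -> : trig C (x + y) - trig C x = \sum_(r in C) a r * e r x * (e r y - 1).
    by rewrite /trig -sumrB; apply: eq_bigr => r _; rewrite eDr; ring.
  apply: le_trans (ler_normc_sum _ _ _) _.
  apply: (@le_trans _ _ (wt C * (2 * delta))).
    rewrite /wt mulr_suml; apply: ler_sum => r rC.
    rewrite !ComplexField.Normc.normcM e_normc mulr1 ler_wpM2l ?normc_ge0 //.
    exact: inv.
  have : wt C * (2 * delta) <= M * (2 * delta).
    rewrite ler_wpM2r ?mulr_ge0 //; apply: le_trans wtM; exact: wtS (subsetT _).
  by lra.
(* Go to a point [x + y] where the uncovered part is at most 1/12, subtract at most 1/12 for the new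
   frequencies, and return to [x] at a cost of 1/24: 1/3 - 1/12 - 1/12 - 1/24 = 1/8. *)
have gbig x : 1 / 8 <= `|g x|.
  have [y yS le] := small x.
  have le1 : normc (trig (~: C') (x + y)) <= 1 / 12.
    rewrite -(@ler_pXn2r _ 2) ?nnegrE ?normc_ge0 //; last by lra.
    by apply: le_trans le (le_trans Meps _); lra.
  have := fbig (x + y).
  rewrite (trigD _ (subsetT C')) (trigD _ sC).
  have := le_trans (ler_Re_normc _) (le_trans (normc_trig _ (x + y)) wtD).
  have := le_trans (ler_Re_normc _) le1; rewrite -setTD.
  have := slow x y yS; rewrite /g.
  case: (trig C _) (trig (C' :\: C) _) (trig (setT :\: C') _) (trig C x).
  move=> u1 ? [u2 ?] [u3 ?] [u4 ?] /=.
  rewrite !ler_norml !ler_normr => /andP[? ?] /andP[? ?] /andP[? ?] /orP[?|?].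
    by apply/orP; left; lra.
  by apply/orP; right; lra.
have gsum : \sum_x g x = 0.
  rewrite -Re_sum exchange_big big1 //= => r _; rewrite -mulr_sumr.
  by have [->|r0] := eqVneq r 0; rewrite ?a0 ?mul0r // sum_e // mulr0.
(* A change of sign would be a jump of at least 1/4. *)
have step x : (0 < g x) -> (0 < g (x + t)).
  move: (slow x t tS) (gbig x) (gbig (x + t)).
  rewrite ler_norml !ler_normr => /andP[? ?] /orP[?|?] /orP[?|?] ?; lra.
have step' x : (g x < 0) -> (g (x + t) < 0).
  move: (slow x t tS) (gbig x) (gbig (x + t)).
  rewrite ler_norml !ler_normr => /andP[? ?] /orP[?|?] /orP[?|?] ?; lra.
have Gn0 : has predT (index_enum G).
  by apply/hasP; exists 0; rewrite ?mem_index_enum.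
have [g0|g0|g0] := ltgtP (g 0) 0.
- have : \sum_x g x < \sum_(x : G) 0.
    apply: ltr_sum => // x _; have [k ->] := G_cyclic x t0.
    by elim: k => [|k IH]; rewrite ?mulr0n // mulrSr step'.
  by rewrite gsum big1_eq ltxx.
- have : \sum_(x : G) 0 < \sum_x g x.
    apply: ltr_sum => // x _; have [k ->] := G_cyclic x t0.
    by elim: k => [|k IH]; rewrite ?mulr0n // mulrSr step.
  by rewrite gsum big1_eq ltxx.
by have := gbig 0; rewrite g0 normr0; lra.
Qed.

(** Rescaling [-1, 1] to [0, K] puts [u] and [v] in the same unit interval. *)
Lemma truncn_close (K : nat) (u v : R) : (0 < K)%N -> `|u| <= 1 -> `|v| <= 1 ->
    Num.truncn ((1 + u) * K%:R / 2) = Num.truncn ((1 + v) * K%:R / 2) ->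
  `|u - v| <= 2 / K%:R.
Proof.
move=> K0; rewrite !ler_norml => /andP[u1 u2] /andP[v1 v2] E.
have K0' : 0 < K%:R :> R by rewrite ltr0n.
have pos (w : R) : -1 <= w -> 0 <= (1 + w) * K%:R / 2.
  by move=> w1; rewrite divr_ge0 // mulr_ge0 // ?ler0n //; lra.
have := truncn_itv (pos u u1); have := truncn_itv (pos v v1); rewrite E.
move: (Num.truncn _) => k; rewrite -[k.+1%:R]natr1 => /andP[h1 h2] /andP[h3 h4].
rewrite -ler_norml ler_pdivlMr // -[X in _ * X]gtr0_norm // -normrM mulrBl.
by rewrite ler_norml; apply/andP; split; lra.
Qed.

(** Pigeonhole on the values of the characters in [S]: two points in one cell differ by an element
    of the Bohr set, real and imaginary parts costing [2 / K] each. *)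
Lemma bohr_nontrivial (S : seq G) (K : nat) (rho : R) : (0 < K)%N ->
    4 / K%:R <= rho -> (K.+1 ^ (2 * size S) < #|G|)%N ->
  exists2 t, t \in bohr S rho & t != 0.
Proof.
move=> K0 le lt.
(* The endpoint [u = 1] falls into cell [K], hence [K.+1] cells per coordinate. *)
pose box (u : R) : 'I_K.+1 := inord (Num.truncn ((1 + u) * K%:R / 2)).
pose cell x := map_tuple (fun r => (box (Re (e r x)), box (Im (e r x))))
  (in_tuple S).
have /injectivePn[x [y xy cxy]] : ~~ injectiveb cell.
  apply: contraL lt => /injectiveP/leq_card.
  by rewrite card_tuple card_prod card_ord mulnn -expnM -leqNgt.
exists (x - y); last by rewrite subr_eq0.
apply/bohrP => r rS; apply: le_trans le.
have -> : normc (e r (x - y) - 1) = normc (e r x - e r y).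
  rewrite -[LHS]mulr1 -(e_normc r y) -ComplexField.Normc.normcM.
  by rewrite mulrBl mul1r -eDr subrK.
have boxP (u : R) : `|u| <= 1 ->
    box u = Num.truncn ((1 + u) * K%:R / 2) :> nat.
  rewrite ler_norml => /andP[u1 u2]; rewrite inordK //= ltnS truncn_le_nat.
  rewrite -[K.+1%:R]natr1; have : 0 < K%:R :> R by rewrite ltr0n.
  by move=> K1; have := ler_wpM2r (ltW K1) u2; lra.
have [/val_eqP/= bR /val_eqP/= bI] :
    box (Re (e r x)) = box (Re (e r y)) /\ box (Im (e r x)) = box (Im (e r y)).
  have /(congr1 val)/= /eq_in_map/(_ r rS)[h1 h2] := cxy.
  by rewrite h1 h2.
have nR z : `|Re (e r z)| <= 1 by rewrite -(e_normc r z) ler_Re_normc.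
have nI z : `|Im (e r z)| <= 1 by rewrite -(e_normc r z) ler_Im_normc.
move: bR bI; rewrite !boxP // => /eqP bR /eqP bI.
apply: le_trans (ler_normc_ReIm _) _.
have -> : 4 / K%:R = 2 / K%:R + 2 / K%:R :> R by rewrite -mulrDl -natrD.
have := truncn_close K0 (nR x) (nR y) bR.
have := truncn_close K0 (nI x) (nI y) bI.
by case: (e r x) (e r y) => u1 u2 [v1 v2] /= ? ?; apply: lerD.
Qed.

(** Were [G] larger, [bohr_nontrivial] would put a nonzero element in the Bohr set of a good level,
    against [no_small_period]. *)
Lemma card_le_of_wt (m n : nat) : (0 < m)%N ->
    a 0 = 0 -> (forall x, 1 / 3 <= `|Re (trig [set: G] x)|) ->
    wt [set: G] <= m%:R ->
    #|G|%:R < (1 + (27648 * m ^ 3)%N%:R^-1) ^+ n :> R ->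
  (#|G| <= (192 * m * n.+1 ^ (12 * m).+1).+1 ^ (2 * (288 * m ^ 2)))%N.
Proof.
move=> m0 a0 fbig wtm lt; rewrite leqNgt; apply/negP => ltG.
have m0' : 0 < m%:R :> R by rewrite ltr0n.
have mn0 : m%:R != 0 :> R by rewrite gt_eqF.
(* All constraints become equalities: [m * eps] is 1/144, the square of 1/12; [m * delta] is 1/48;
   [eta * m] is [eps / 2]; and 27648 = 2 * 288 * 48 comes from [2 * tau = eta * delta]. *)
pose eps : R := (144 * m%:R)^-1; pose delta : R := (48 * m%:R)^-1.
pose eta : R := (288 * m%:R ^+ 2)^-1.
have eps0 : 0 < eps by rewrite invr_gt0 mulr_gt0.
have delta0 : 0 < delta by rewrite invr_gt0 mulr_gt0.
have eta0 : 0 < eta by rewrite invr_gt0 mulr_gt0 // exprn_gt0.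
have tau0 : 0 < (27648 * m ^ 3)%N%:R^-1 :> R.
  by rewrite invr_gt0 ltr0n muln_gt0 expn_gt0 m0.
have h1 : eta * m%:R <= eps / 2.
  by rewrite le_eqVlt; apply/orP; left; apply/eqP; rewrite /eta /eps; field.
have h2 : 2 * (27648 * m ^ 3)%N%:R^-1 <= eta * delta.
  rewrite natrM natrX le_eqVlt; apply/orP; left; apply/eqP.
  by rewrite /eta /delta; field.
(* With 1/12 of mass gained per level, [12 * m + 1] levels would exceed the total mass. *)
have h3 : m%:R < (12 * m).+1%:R * (1 / 12) :> R.
  by rewrite -[(12 * m).+1%:R]natr1 natrM; lra.
have [S [C [C' [rho [sC [rhoJ szS] inv wtC small]]]]] :=
  good_level eps0 eta0 tau0 delta0 wtm h1 h2 lt h3.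
have szS' : (size S <= 288 * m ^ 2)%N.
  rewrite -(ler_nat R) natrM natrX.
  have : (size S)%:R * (eps / 2) * (288 * m%:R) <= m%:R * (288 * m%:R).
    by rewrite ler_wpM2r // mulr_ge0 // ltW.
  have -> : (size S)%:R * (eps / 2) * (288 * m%:R) = (size S)%:R.
    by rewrite /eps; field.
  by rewrite mulrCA expr2.
(* Chosen so that [4 / K] equals the radius guaranteed by [good_level]. *)
pose K := (192 * m * n.+1 ^ (12 * m).+1)%N.
have K0 : (0 < K)%N by rewrite !muln_gt0 m0 expn_gt0.
have [||t tS /eqP t0] := @bohr_nontrivial S K rho K0.
- apply: le_trans rhoJ; rewrite le_eqVlt; apply/orP; left; apply/eqP.
  rewrite /K !natrM natrX /delta; field.
  by rewrite mn0 expf_neq0 // pnatr_eq0.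
- by apply: leq_ltn_trans ltG; rewrite leq_exp2l ?ltnS // leq_mul2l.
apply: t0.
apply: (no_small_period a0 fbig wtm _ _ (ltW delta0) sC inv wtC small tS).
  by rewrite le_eqVlt; apply/orP; left; apply/eqP; rewrite /eps; field.
by rewrite le_eqVlt; apply/orP; left; apply/eqP; rewrite /delta; field.
Qed.

End Bicharacter.

(** * The complex exponential on the unit circle *)

Section Expi.
Variable R : realType.
Implicit Types s t : R.

Lemma expi0 : expi 0 = 1 :> R[i].
Proof. by rewrite /expi cos0 sin0. Qed.

Lemma expiD s t : expi (s + t) = expi s * expi t.
Proof. by rewrite /expi cosD sinD; simpc; rewrite [sin s * _ + _]addrC. Qed.

Lemma expi_natM k t : expi (k%:R * t) = expi t ^+ k.
Proof.
elim: k => [|k IH]; first by rewrite mul0r expi0 expr0.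
by rewrite -natr1 mulrDl mul1r expiD IH exprSr.
Qed.

Lemma normc_expi t : normc (expi t) = 1.
Proof. by rewrite /= cos2Dsin2 sqrtr1. Qed.

Lemma expi_2pi : expi (2 * pi) = 1 :> R[i].
Proof. by rewrite mulr_natl /expi cos2pi sin2pi. Qed.

(** Here cos t = 1 - 2 sin(t/2)^2, and the sine is positive on (0, pi). *)
Lemma expi_neq1 t : 0 < t < 2 * pi -> expi t != 1.
Proof.
move=> /andP[t0 t1]; apply/eqP => -[c1 _].
have : 0 < sin (t / 2) by apply: sin_gt0_pi; apply/andP; split; lra.
move=> /(exprn_gt0 2); rewrite sin2cos2 => lt; move: c1.
have -> : t = t / 2 + t / 2 by lra.
rewrite cosD -!expr2 sin2cos2; lra.
Qed.

End Expi.

(** * Characters and Fourier inversion on Z/pZ *)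

Section PrimeField.
Variables (R : realType) (p : nat).
Hypothesis p_pr : prime p.
Implicit Types (r x y : 'F_p) (A : {set 'F_p}).

(** Conjugated because [fourier] has a plus sign in its exponent: [chi] is the kernel of the inverse
    transform. *)
Definition chi r x : R[i] :=
  Num.conj (expi (2 * pi * (r * x)%N%:R / p%:R)).

Let p_gt0 : (0 < p)%N := prime_gt0 p_pr.
Let pR_neq0 : p%:R != 0 :> R.
Proof. by rewrite pnatr_eq0 -lt0n. Qed.

Lemma chiE r x : chi r x = Num.conj (expi (2 * pi / p%:R)) ^+ (r * x).
Proof.
by rewrite /chi -rmorphXn -expi_natM; congr (Num.conj (expi _)); field.
Qed.

(** The base is a [p]-th root of unity. This reconciles products of representatives with the
    arithmetic of ['F_p]. *)
Lemma chi_mod k :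
  Num.conj (expi (2 * pi / p%:R : R)) ^+ (k %% p) =
  Num.conj (expi (2 * pi / p%:R)) ^+ k.
Proof.
apply: expr_mod; rewrite -rmorphXn -expi_natM mulrC divfK //.
by rewrite expi_2pi rmorph1.
Qed.

Lemma chiC r x : chi r x = chi x r.
Proof. by rewrite /chi mulnC. Qed.

Lemma chiDr r x y : chi r (x + y) = chi r x * chi r y.
Proof.
rewrite !chiE -exprD -mulnDr /= [X in (_ * (_ %% X))%N]Fp_cast //.
by rewrite -chi_mod modnMmr chi_mod.
Qed.

Lemma chiDl x y r : chi (x + y) r = chi x r * chi y r.
Proof. by rewrite chiC chiDr !(chiC r). Qed.

Lemma normc_chi r x : normc (chi r x) = 1.
Proof. by rewrite normc_conj normc_expi. Qed.

Lemma chi_neq1 r : r != 0 -> chi r 1 != 1.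
Proof.
move=> r0; rewrite /chi -[X in _ != X]conjC1 (inj_eq (inv_inj conjCK)).
have -> : (1%R : 'F_p) = 1%N :> nat by [].
rewrite muln1; apply: expi_neq1.
have r_gt0 : 0 < r%:R :> R by rewrite ltr0n lt0n.
have ltrp : r%:R < p%:R :> R.
  by rewrite ltr_nat -[X in (_ < X)%N](Fp_cast p_pr) ltn_ord.
have p0 : 0 < p%:R :> R by rewrite ltr0n.
have pi0 := pi_gt0 R.
rewrite divr_gt0 ?mulr_gt0 //= ltr_pdivrMr // ltr_pM2l // mulr_gt0 //.
Qed.

(** Translation by 1 multiplies the sum by [chi r 1], which is not 1. *)
Lemma sum_chi r : r != 0 -> \sum_x chi r x = 0.
Proof.
move=> r0; apply/eqP; apply: contraT => S0; case/negP: (chi_neq1 r0).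
apply/eqP; apply: (mulIf S0); rewrite mul1r mulr_sumr.
rewrite [RHS](reindex_inj (addrI 1)).
by apply: eq_bigr => x _; rewrite chiDr.
Qed.

Lemma Fp_cyclic (t x : 'F_p) : t != 0 -> exists n, x = t *+ n.
Proof.
(* The quotient is coerced to its representative in {0, .., p - 1}. *)
move=> t0; exists (x / t : 'F_p).
by rewrite -mulr_natr natr_Zp mulrC divfK.
Qed.

(** After exchanging the sums, orthogonality leaves only the term [y = x]. *)
Lemma fourier_inversion (f : 'F_p -> R) x :
  \sum_r fourier f r * chi r x = (f x)%:C.
Proof.
have cn0 : p%:R != 0 :> R[i] by rewrite pnatr_eq0 -lt0n.
transitivity (p%:R^-1 * \sum_y (f y)%:C * \sum_r chi (x - y) r).
  rewrite mulr_sumr.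
  under [RHS]eq_bigr => y _ do rewrite mulrA mulr_sumr.
  rewrite exchange_big; apply: eq_bigr => r _.
  rewrite /fourier mulr_sumr mulr_suml; apply: eq_bigr => y _.
  rewrite mulrA -[LHS]mulrA; congr (_ * _).
  rewrite chiDl mulrC (chiC x); congr (_ * _).
  rewrite -(e_conj chiDl normc_chi) chiC.
  by rewrite /chi conjCK.
rewrite (bigD1 x) //= [X in _ + X]big1 ?addr0 => [|y yx].
  rewrite subrr (eq_bigr (fun=> 1)) => [|r _]; last first.
    exact: (e0r chiDl normc_chi).
  by rewrite sumr_const card_Fp // mulrCA mulVf ?mulr1.
by rewrite sum_chi ?mulr0 // subr_eq0 eq_sym.
Qed.

Lemma fourier_charfun0 A :
  fourier (charfun R A) 0 = (#|A|%:R / p%:R)%:C.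
Proof.
rewrite /fourier (eq_bigr (fun x => (charfun R A x)%:C)) => [|x _]; last first.
  by rewrite mul0n mulr0 mul0r expi0 mulr1.
rewrite -rmorph_sum /charfun -natr_sum mulrC.
have -> : (\sum_i (i \in A))%N = #|A|.
  by rewrite -sum1_card [RHS]big_mkcond; apply: eq_bigr => i _; case: (i \in A).
by rewrite rmorphM fmorphV !rmorph_nat.
Qed.

(** As [p] is odd, the density is h/(2h + 1) with h >= 1. Hence 1_A - |A|/p has modulus at least 1/2
    on [A] and at least 1/3 off [A]. *)
Lemma half_density A : (3 <= p)%N -> #|A| = p./2 ->
  1 / 3 <= #|A|%:R / p%:R :> R /\ #|A|%:R / p%:R <= 1 / 2 :> R.
Proof.
move=> p3 ->.
have odd_p : odd p by have [p2|//] := even_prime p_pr; move: p3; rewrite p2.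
have p0 : 0 < p%:R :> R by rewrite ltr0n.
have E : p%:R = 1 + 2 * (p./2)%:R :> R.
  by rewrite -{1}[p]odd_double_half odd_p natrD -mul2n natrM.
have h1 : 1 <= (p./2)%:R :> R by rewrite ler1n; case: (p) p3 => [|[|]].
by rewrite ler_pdivlMr // ler_pdivrMr // E; split; lra.
Qed.

(** The zero frequency alone contributes the density of [A]. *)
Lemma l1_fourier_ge A : (3 <= p)%N -> #|A| = p./2 ->
  1 / 3 <= \sum_r modulus (fourier (charfun R A) r).
Proof.
move=> p3 cA; have [h _] := half_density p3 cA.
rewrite (bigD1 0) //= {1}/modulus fourier_charfun0 normc_real.
apply: (le_trans h); apply: (le_trans (ler_norm _)).
by rewrite lerDl sumr_ge0 // => r _; exact: normc_ge0.
Qed.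

(** Deleting the zero frequency replaces 1_A by 1_A - |A|/p without increasing the l1 norm, so that
    [card_le_of_wt] applies. *)
Lemma prime_le_of_l1_fourier A (m n : nat) : (3 <= p)%N -> #|A| = p./2 ->
    (0 < m)%N -> \sum_r modulus (fourier (charfun R A) r) <= m%:R ->
    p%:R < (1 + (27648 * m ^ 3)%N%:R^-1) ^+ n :> R ->
  (p <= (192 * m * n.+1 ^ (12 * m).+1).+1 ^ (2 * (288 * m ^ 2)))%N.
Proof.
move=> p3 cA m0 le ltp; rewrite -{1}(card_Fp p_pr).
pose a r := if r == 0 then 0 else fourier (charfun R A) r.
apply: (@card_le_of_wt R _ chi chiDl chiDr normc_chi a sum_chi
  Fp_cyclic _ _ m0).
- by rewrite /a eqxx.
- move=> x; have -> : trig chi a [set: 'F_p] x =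
     (charfun R A x - #|A|%:R / p%:R)%:C.
    rewrite rmorphB /= -fourier_charfun0 -(fourier_inversion _ x) /trig.
    rewrite (eq_bigl predT) => [|r]; last by rewrite inE.
    rewrite (bigD1 0) //= [in RHS](bigD1 0) //= /a eqxx mul0r add0r.
    rewrite (e0r chiDl normc_chi) mulr1 addrAC subrr add0r.
    by apply: eq_bigr => r /negPf ->.
  rewrite /= /charfun; have [h1 h2] := half_density p3 cA.
  rewrite ler_normr; case: (x \in A);
    rewrite ?mulr1n ?mulr0n /=; apply/orP; [left|right]; lra.
- apply: le_trans le; rewrite /wt (eq_bigl predT) => [|r]; last by rewrite inE.
  apply: ler_sum => r _; rewrite /a; case: eqP => _ //.
  by rewrite ComplexField.Normc.normc0 normc_ge0.
by rewrite card_Fp.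
Qed.

End PrimeField.

(** * Logarithmic estimates *)

Section Logarithms.
Variable R : realType.

Lemma bernoulli (x : R) n : 0 <= x -> 1 + n%:R * x <= (1 + x) ^+ n.
Proof.
move=> x0; elim: n => [|n IH]; first by rewrite mul0r addr0 expr0.
have x1 : 0 <= 1 + x by lra.
rewrite exprS -natr1; apply: le_trans (ler_wpM2l x1 IH).
have : 0 <= n%:R * x * x by rewrite !mulr_ge0.
by lra.
Qed.

(** By Bernoulli (1 + 1/T)^T >= 2, so about T log p steps suffice for regularity. *)
Lemma lt_expr_trunc_log (T p : nat) : (0 < T)%N ->
  p%:R < (1 + T%:R^-1) ^+ (T * (trunc_log 2 p).+1) :> R.
Proof.
move=> T0; have T0' : T%:R != 0 :> R by rewrite pnatr_eq0 -lt0n.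
rewrite exprM; apply: (@lt_le_trans _ _ (2 ^+ (trunc_log 2 p).+1)).
  by rewrite -natrX ltr_nat trunc_log_ltn.
rewrite lerXn2r ?nnegrE ?exprn_ge0 ?addr_ge0 ?invr_ge0 ?ler0n //.
have := @bernoulli T%:R^-1 T; rewrite invr_ge0 ler0n mulfV //.
by move=> /(_ isT).
Qed.

Lemma ln2_ge : 1 / 2 <= ln 2 :> R.
Proof.
(* Bounding ln(1/2) from above bounds ln 2 from below. *)
have := @le_ln1Dx R (- (1 / 2)).
have -> : 1 + - (1 / 2) = 2^-1 :> R by lra.
rewrite lnV ?posrE //; lra.
Qed.

Lemma trunc_log2_le p : (0 < p)%N -> (trunc_log 2 p)%:R <= 2 * ln p%:R :> R.
Proof.
move=> p0; have := trunc_logP (isT : (1 < 2)%N) p0.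
rewrite -(ler_nat R) natrX => h.
have : ln (2 ^+ trunc_log 2 p) <= ln p%:R :> R.
  by rewrite ler_ln ?posrE ?exprn_gt0 ?ltr0n.
rewrite lnXn // -[ln 2 *+ _]mulr_natl.
have := ler_wpM2l (ler0n R (trunc_log 2 p)) ln2_ge.
lra.
Qed.

(** The factor [192 * m] costs one more power of [X]; then 12m + 2 <= 14m and 14 * 576 = 8064. *)
Lemma expn_absorb m X : (0 < m)%N -> (192 * m < X)%N ->
  ((192 * m * X ^ (12 * m).+1).+1 ^ (2 * (288 * m ^ 2)) <=
     X ^ (8064 * m ^ 3))%N.
Proof.
move=> m0 mX; have X0 : (0 < X)%N by apply: leq_ltn_trans mX.
apply: (@leq_trans ((X ^ (14 * m)) ^ (2 * (288 * m ^ 2)))).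
  rewrite leq_exp2r ?muln_gt0 ?expn_gt0 ?m0 //.
  apply: (@leq_trans (X ^ (12 * m).+2)); last first.
    rewrite leq_pexp2l //.
    have -> : (14 * m = 12 * m + 2 * m)%N by rewrite -mulnDl.
    by rewrite -addn2 leq_add2l leq_pmulr.
  rewrite [X in (_ <= X)%N]expnS.
  apply: (@leq_trans ((192 * m).+1 * X ^ (12 * m).+1)).
    by rewrite mulSn -add1n leq_add2r expn_gt0 X0.
  by rewrite leq_mul2r mX orbT.
rewrite -expnM leq_pexp2l // leq_eqVlt; apply/orP; left; apply/eqP.
by ring.
Qed.

(** Here 90^2 rounds up 8064, 300^2 rounds up 3 * 27648 + 1, and the summand 2 is the power of ln p
    in the bound for [n.+1]. *)
Definition loglog_const : R := 90 ^+ 2 * (ln (300 ^+ 2) + 2).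

Lemma loglog_const_ge1 : 1 <= loglog_const.
Proof.
have : 0 <= ln (300 ^+ 2) :> R by apply: ln_ge0; lra.
by rewrite /loglog_const; lra.
Qed.

(** Taking logarithms, ln p <= 8064 m^3 ln(n + 1). Once m^3 < ln p, [n] is at most quadratic in ln
    p, so that ln(n + 1) = O(ln ln p). *)
Lemma log_div_loglog_le (p m : nat) : (0 < p)%N -> (0 < m)%N ->
    1 <= ln (ln p%:R) :> R ->
    let T := (27648 * m ^ 3)%N in let n := (T * (trunc_log 2 p).+1)%N in
    (p <= (192 * m * n.+1 ^ (12 * m).+1).+1 ^ (2 * (288 * m ^ 2)))%N ->
  ln p%:R / ln (ln p%:R) <= loglog_const * m%:R ^+ 3.
Proof.
move=> p0 m0 ll1 T n lep.
set l := ln p%:R in ll1 *; set ll := ln l in ll1 *.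
have l1 : 1 <= l.
  by rewrite leNgt; apply/negP => /ltW/ln_le0; rewrite -/ll; lra.
have K1 := loglog_const_ge1.
have m1 : 1 <= m%:R ^+ 3 :> R by rewrite exprn_ege1 // ler1n.
rewrite ler_pdivrMr; last by lra.
(* If [l <= m ^ 3] the claim is immediate, as [ll] and the constant are at least 1. *)
have [lm|ml] := leP l (m%:R ^+ 3).
  have Km := ler_wpM2r (le_trans ler01 m1) K1.
  have Km0 : 0 <= loglog_const * m%:R ^+ 3 by lra.
  by have := ler_wpM2l Km0 ll1; lra.
have Tm : (192 * m < n.+1)%N.
  rewrite ltnS /n /T -mulnA; apply: leq_mul.
    by rewrite -(ler_nat R); lra.
  by rewrite expnSr -mulnA mulnCA leq_pmulr // muln_gt0 expn_gt0 m0.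
have lepX := leq_trans lep (expn_absorb m0 Tm).
have X0 : 0 < n.+1%:R :> R by rewrite ltr0n.
have h1 : l <= ((8064 * m ^ 3)%N%:R) * ln n.+1%:R.
  have : l <= ln (n.+1%:R ^+ (8064 * m ^ 3)).
    by rewrite ler_ln ?posrE ?exprn_gt0 ?ltr0n // -natrX ler_nat.
  by rewrite lnXn // -[ln _ *+ _]mulr_natl.
apply: (le_trans h1).
have h2 : n.+1%:R <= 300 ^+ 2 * l ^+ 2.
  have hL : (trunc_log 2 p).+1%:R <= 3 * l.
    by rewrite -natr1; have := trunc_log2_le p0; rewrite -/l; lra.
  have : (m%:R ^+ 3) * (trunc_log 2 p).+1%:R <= l * (3 * l).
    by apply: ler_pM => //; lra.
  have : 1 <= l ^+ 2 by rewrite exprn_ege1.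
  rewrite -[n.+1%:R]natr1 /n /T natrM [(27648 * _)%:R]natrM natrX expr2; lra.
have h3 : ln n.+1%:R <= ln (300 ^+ 2) + 2 * ll.
  have -> : ln (300 ^+ 2) + 2 * ll = ln (300 ^+ 2 * l ^+ 2).
    by rewrite lnM ?posrE ?exprn_gt0 // ?[ln (l ^+ 2)]lnXn ?mulr_natl //; lra.
  by rewrite ler_ln // posrE; lra.
have l0 : 0 <= ln (300 ^+ 2) :> R by apply: ln_ge0; lra.
have h4 : ln n.+1%:R <= (ln (300 ^+ 2) + 2) * ll.
  by have := ler_wpM2l l0 ll1; lra.
have := ler_wpM2l (le_trans ler01 m1) h4.
by rewrite /loglog_const; lra.
Qed.

End Logarithms.

(** * Choice of the absolute constant *)

Theorem theorem1p2 (R : realType) :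
  exists c : R, 0 < c /\
    forall p : nat, prime p -> (3 <= p)%N ->
    forall A : {set 'F_p}, #|A| = p./2 ->
      c * (ln p%:R / ln (ln p%:R)) `^ (1 / 3)
        <= \sum_(r : 'F_p) modulus (fourier (charfun R A) r).
Proof.
pose F (p : nat) : R := (ln p%:R / ln (ln p%:R)) `^ (1 / 3).
(* From [P] on, [ln (ln p)] is at least 1. *)
pose P := (Num.truncn (expR (expR 1) : R)).+1.
pose D : R := \sum_(p < P) F p.
have F0 p : 0 <= F p by exact: powR_ge0.
have D0 : 0 <= D by apply: sumr_ge0.
have K1 := loglog_const_ge1 R; set K := loglog_const R in K1.
(* For large [p], [F p <= K * m <= 4 * K * S]; for small [p], [F p <= D <= 3 * D * S]. The sum
   serves both ranges. *)
exists (4 * K + 3 * D)^-1.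
have den0 : 0 < 4 * K + 3 * D by lra.
split=> [|p p_pr p3 A cA]; first by rewrite invr_gt0.
rewrite -/(F p) mulrC ler_pdivrMr //.
have := l1_fourier_ge R p_pr p3 cA; set S := \sum_r _ => S3.
have [ltp|lep] := ltnP p P.
  (* finitely many p: here the trivial bound S >= 1/3 suffices *)
  have : F p <= D.
    by rewrite /D (bigD1 (Ordinal ltp)) //= lerDl sumr_ge0.
  have : 0 <= S * (4 * K) by rewrite mulr_ge0 //; lra.
  by have := ler_wpM2r D0 S3; lra.
have p0 : (0 < p)%N by apply: leq_trans p3.
have lnp : expR 1 <= ln p%:R :> R.
  rewrite -[expR 1]expRK ler_ln ?posrE ?expR_gt0 ?ltr0n //.
  have /andP[_ /ltW lt] := truncn_itv (ltW (expR_gt0 (expR 1 : R))).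
  by apply: (le_trans lt); rewrite ler_nat.
have e0 := expR_gt0 (1 : R).
have ll1 : 1 <= ln (ln p%:R) :> R.
  by rewrite -[leLHS]expRK ler_ln ?posrE //; lra.
pose m := (Num.truncn S).+1.
have S0 : 0 <= S by lra.
have /andP[mS Sm] := truncn_itv S0.
(* Here [m <= S + 1], and 1 <= 3S by the trivial bound. *)
have mS' : m%:R <= 4 * S by rewrite /m -natr1; lra.
have T0 : (0 < 27648 * m ^ 3)%N by rewrite muln_gt0 expn_gt0.
have bound := prime_le_of_l1_fourier p_pr p3 cA (ltn0Sn _) (ltW Sm)
  (lt_expr_trunc_log R p T0).
have := log_div_loglog_le p0 (ltn0Sn _ : (0 < m)%N) ll1 bound.
rewrite -/K => le3.
have q0 : 0 <= ln p%:R / ln (ln p%:R) :> R by rewrite divr_ge0; lra.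
have F3 : F p ^+ 3 = ln p%:R / ln (ln p%:R).
  by rewrite -powR_mulrn // /F -powRrM mul1r mulVf ?powRr1 ?pnatr_eq0.
have K0 : 0 <= K by lra.
have Km0 : 0 <= K * m%:R by exact: mulr_ge0.
(* Compare cubes, using [K <= K ^ 3] for [K >= 1]. *)
have FKm : F p <= K * m%:R.
  rewrite -(@ler_pXn2r _ 3) ?nnegrE //.
  rewrite F3 exprMn; apply: le_trans le3 _.
  by rewrite ler_wpM2r ?exprn_ge0 // ler_eXnr.
have := ler_wpM2l K0 mS'; have := mulr_ge0 S0 D0.
by lra.
Qed.
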